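(* Let $G=(V,E)$ be a finite graph with $c$ connected components, let $\mathbf{k}$ be a field, and let $\pi$ be an ordered partition of $V$. Let $\mathcal{G}_\pi\subseteq \mathbf{k}^{\mathbb{E}}$ be the $\pi$-residue space. Then $$\dim_{\mathbf{k}}\mathcal{G}_\pi=|E|-|V|+c.$$
   Context: Graphs are finite; loops and multiple edges are allowed. $\mathbb{E}$ denotes the set of arrows of $G$: each edge $e=\{v,w\}$ gives two arrows $v\to w$ and $w\to v$ (a loop also gives two distinct arrows, corresponding to its two half-edges). If $a$ is an arrow $v\to w$, its tail is $v$, its head is $w$, and $\bar a$ denotes the reverse arrow on the same edge. For $v\in V$, $\mathbb{E}_v$ is the set of arrows with tail $v$. An ordered partition $\pi=(\pi_1,\dots,\pi_r)$ of $V$ is a partition of $V$ into nonempty parts together with a total order on the parts; its level function is $h:V\to[r]=\{1,\dots,r\}$, with $h(v)=n$ iff $v\in\pi_n$. An edge $\{u,v\}$ is vertical if $h(u)\ne h(v)$ and horizontal otherwise; an arrow is vertical or horizontal according to its edge. A vertical arrow $u\to v$ is upward if $h(u)>h(v)$ and downward if $h(u)<h(v)$. Let $A_\pi$ be the set of upward arrows and $\bar A_\pi$ the set of downward arrows. The $\pi$-residue space $\mathcal{G}_\pi$ is the subspace of all $\psi=(\psi_a)_{a\in\mathbb{E}}\in\mathbf{k}^{\mathbb{E}}$ satisfying the following four conditions: (R1) $\psi_a=0$ for every downward arrow $a\in\bar A_\pi$. (R2) $\sum_{a\in\mathbb{E}_v}\psi_a=0$ for every $v\in V$. (R3) $\psi_a+\psi_{\bar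 a}=0$ for every horizontal arrow $a$. (R4) For each $n\in[r]$ and each connected component $\Xi$ of the induced subgraph $G[\{v\in V: h(v)<n\}]$, $\sum_{a}\psi_a=0$, where the sum runs over all upward arrows $a$ with tail of level $n$ and head in $\Xi$. *)

(* Defs.v *)
From HB Require Import structures.
From mathcomp Require Import all_boot all_order all_algebra.

Set Implicit Arguments.
Unset Strict Implicit.
Unset Printing Implicit Defensive.

Import GRing.Theory.
Local Open Scope ring_scope.

(* Finite multigraphs with loops.  The pair [ends e] fixes a reference         *)
(* orientation of the edge [e], used only to name its two half-edges; the      *)
(* graph is undirected, since both arrows on [e] are always considered.        *)
Record graph := Graph {
  vertex :> finType;
  edge : finType;
  ends : edge -> vertex * vertex
}.

(* [(e, false)] goes from [(ends e).1] to [(ends e).2] and [(e, true)] goes    *)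
(* back; in particular a loop carries two distinct arrows.                     *)
Definition arrow (G : graph) : finType := (edge G * bool)%type.

Section Graph.
Variable G : graph.

Definition tail (a : arrow G) : G :=
  if a.2 then (ends a.1).2 else (ends a.1).1.
Definition head (a : arrow G) : G :=
  if a.2 then (ends a.1).1 else (ends a.1).2.
Definition bar (a : arrow G) : arrow G := (a.1, ~~ a.2).

Definition arrows_from (v : G) : {set arrow G} := [set a | tail a == v].

Definition adj_in (W : {set G}) : rel G := fun u w =>
  [&& u \in W, w \in W & [exists a : arrow G, (tail a == u) && (head a == w)]].

(* Vertex sets of the connected components of the induced subgraph G[W].       *)
Definition components (W : {set G}) : {set {set G}} :=
  equivalence_partition (connect (adj_in W)) W.

(* [uniq] is needed because [set B in parts] forgets repetitions; [partition]  *)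
(* already excludes the empty set.                                             *)
Record ordered_partition := OrderedPartition {
  parts :> seq {set G};
  _ : uniq parts;
  _ : partition [set B in parts] [set: G]
}.

Variable pi : ordered_partition.

(* Levels are numbered from 1 to [size pi].                                    *)
Definition level (v : G) : nat :=
  (find (fun B : {set G} => v \in B) pi).+1.

Definition upward (a : arrow G) : bool := (level (head a) < level (tail a))%N.
Definition downward (a : arrow G) : bool := (level (tail a) < level (head a))%N.
Definition horizontal (a : arrow G) : bool := level (tail a) == level (head a).

Definition below (n : nat) : {set G} := [set v | (level v < n)%N].

Definition upward_into (n : nat) (Xi : {set G}) : {set arrow G} :=
  [set a | [&& upward a, level (tail a) == n & head a \in Xi]].

Variable k : fieldType.

Definition arrow_sum (A : {set arrow G}) (psi : {ffun arrow G -> k^o}) : k^o :=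
  \sum_(a in A) psi a.

Fact arrow_sum_is_linear A : linear (arrow_sum A).
Proof.
move=> c x y; rewrite /arrow_sum scaler_sumr -big_split /=.
by apply: eq_bigr => a _; rewrite !ffunE.
Qed.

HB.instance Definition _ A :=
  GRing.isLinear.Build k {ffun arrow G -> k^o} k^o _ (arrow_sum A)
    (arrow_sum_is_linear A).

Definition sum_zero (A : {set arrow G}) : {vspace {ffun arrow G -> k^o}} :=
  lker (linfun (arrow_sum A)).

(* [a] and [bar a] are always distinct, even on a loop, so the third family    *)
(* says psi a + psi (bar a) = 0; see [residue_spaceP].                         *)
Definition residue_space : {vspace {ffun arrow G -> k^o}} :=
  ((\bigcap_(a | downward a) sum_zero [set a])
   :&: (\bigcap_(v : G) sum_zero (arrows_from v))
   :&: (\bigcap_(a | horizontal a) sum_zero [set a; bar a])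
   :&: (\bigcap_(n < (size pi).+1 | (0 < n)%N)
          \bigcap_(Xi in components (below n)) sum_zero (upward_into n Xi)))%VS.

Record residue_conditions (psi : {ffun arrow G -> k^o}) : Prop := {
  res_down : forall a, downward a -> psi a = 0;
  res_vertex : forall v, \sum_(a in arrows_from v) psi a = 0;
  res_horizontal : forall a, horizontal a -> psi a + psi (bar a) = 0;
  res_component : forall n, (1 <= n <= size pi)%N ->
    forall Xi, Xi \in components (below n) ->
    \sum_(a | [&& upward a, level (tail a) == n & head a \in Xi]) psi a = 0
}.

Lemma mem_sum_zero A psi :
  (psi \in sum_zero A) = (\sum_(a in A) psi a == 0).
Proof. by rewrite memv_ker lfunE. Qed.

Lemma mem_bigcapv (I : finType) (P : pred I)
    (U : I -> {vspace {ffun arrow G -> k^o}}) psi :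
  reflect (forall i, P i -> psi \in U i) (psi \in (\bigcap_(i | P i) U i)%VS).
Proof. exact: subv_bigcapP. Qed.

Lemma residue_spaceP psi : psi \in residue_space <-> residue_conditions psi.
Proof.
have pairE a : \sum_(b in [set a; bar a]) psi b = psi a + psi (bar a).
  rewrite big_setU1 ?big_set1 // inE /bar; case: a => e b /=.
  by rewrite xpair_eqE eqxx; case: b.
have intoE n Xi : \sum_(a in upward_into n Xi) psi a =
    \sum_(a | [&& upward a, level (tail a) == n & head a \in Xi]) psi a.
  by apply: eq_bigl => a; rewrite inE.
rewrite /residue_space !memv_cap; split.
  case/andP=> /andP[/andP[/mem_bigcapv h1 /mem_bigcapv h2]].
  move=> /mem_bigcapv h3 /mem_bigcapv h4; split.
  - by move=> a /h1; rewrite mem_sum_zero big_set1 => /eqP.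
  - by move=> v; have := h2 v isT; rewrite mem_sum_zero => /eqP.
  - by move=> a /h3; rewrite mem_sum_zero pairE => /eqP.
  move=> n /andP[n0 nr] Xi XiP.
  have /mem_bigcapv/(_ Xi XiP) := h4 (Ordinal (nr : (n < (size pi).+1)%N)) n0.
  by rewrite mem_sum_zero intoE => /eqP.
case=> h1 h2 h3 h4; apply/andP; split; [apply/andP; split; [apply/andP; split|]|].
- by apply/mem_bigcapv => a /h1 p0; rewrite mem_sum_zero big_set1 p0.
- by apply/mem_bigcapv => v _; rewrite mem_sum_zero h2.
- by apply/mem_bigcapv => a /h3 p0; rewrite mem_sum_zero pairE p0.
apply/mem_bigcapv => n n0; apply/mem_bigcapv => Xi XiP.
by rewrite mem_sum_zero intoE h4 // n0 -ltnS ltn_ord.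
Qed.

End Graph.

(* Main.v *)
From HB Require Import structures.
From mathcomp Require Import all_boot all_order all_algebra.
From mathcomp Require Import zify.
Require Import Defs.
Set Implicit Arguments.
Unset Strict Implicit.
Unset Printing Implicit Defensive.

Import GRing.Theory.
Local Open Scope ring_scope.

(** Write [c n] for the number of components of the subgraph induced on the
    vertices of level less than [n], and [r] for the number of parts.

    By (R1) and (R3), an element of the residue space amounts to one scalar
    per edge, that is, to a flow [phi] along the reference orientations
    ([flow_residue], [residue_flow]).  Give each edge the larger of the levels
    of its two ends.  Every arrow that contributes to (R2) at a vertex of level
    [n], or to (R4) at level [n], lies on an edge of level [n]; so the two
    conditions say that, for each [n], the edges of level [n] carry a flow that
    is conserved on the graph [H_n], whose vertices are the vertices of level
    [n] together with the components of the subgraph strictly below [n], each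
    contracted to a point.  The components of [H_n] are those of the subgraph
    on the levels at most [n].  Hence, with [E_n] the set of edges of level
    [n], the flows on [H_n] have dimension
    [#|E_n| - (#|pi_n| + c n) + c n.+1], and the sum over [n] telescopes to
    [#|E| - #|V| + c (r + 1)], where [c (r + 1)] counts the components of the
    whole graph.

    The graphs [H_n] are handled through functions on them.  A function on the
    vertices of [H_n] is a function on the vertices of level at most [n] that is
    constant on each component strictly below [n]; a family of these, one for
    each [n], is a potential.  The conserved flows are the annihilator of the
    coboundaries of potentials ([residue_annihilator], [annihilator_residue]),
    so their dimension is [#|E|] minus the rank of the coboundary
    ([dim_annihilator]).  The kernel of the coboundary consists of the families
    that are constant on the components at levels at most [n]
    ([ker_coboundary]), so both the space of potentials and this kernel consist
    of functions constant on the fibres of a labelling; their dimensions are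
    numbers of labels ([dim_fibrewise_constant]), which
    [card_lower_upper_class] compares. *)

(** * Annihilators in spaces of finite functions *)

Section Pairing.
Variables (k : fieldType) (I : finType).
Implicit Types (f g : {ffun I -> k^o}) (N : {vspace {ffun I -> k^o}}).

Definition dot f g : k := \sum_i f i * g i.

Lemma dimv_ffun : \dim {: {ffun I -> k^o}} = #|I|.
Proof. by rewrite dimvf /dim /= muln1. Qed.

(** The pairing of [f] with a basis of [N], so that the annihilator of [N] is the
    kernel of a linear map. *)
Definition pairing N f : {ffun 'I_(\dim N) -> k^o} :=
  [ffun j : 'I_(\dim N) => dot f (vbasis N)`_j].

Fact pairing_is_linear N : linear (pairing N).
Proof.
move=> c x y; apply/ffunP => j; rewrite !ffunE /dot scaler_sumr -big_split /=.
by apply: eq_bigr => i _; rewrite !ffunE mulrDl -scalerAl.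
Qed.

HB.instance Definition _ N :=
  GRing.isLinear.Build k {ffun I -> k^o} {ffun 'I_(\dim N) -> k^o} _ (pairing N)
    (pairing_is_linear N).

Definition annihilator N : {vspace {ffun I -> k^o}} :=
  lker (linfun (pairing N)).

Lemma annihilatorP N f :
  reflect (forall g, g \in N -> dot f g = 0) (f \in annihilator N).
Proof.
rewrite memv_ker lfunE /=; apply: (iffP eqP) => [f0 g gN|f0]; last first.
  by apply/ffunP => j; rewrite !ffunE f0 // vbasis_mem ?mem_nth ?size_tuple.
rewrite (coord_vbasis gN) /dot.
under eq_bigr => i _ do rewrite sum_ffunE mulr_sumr.
rewrite exchange_big big1 //= => j _.
have /ffunP/(_ j) := f0; rewrite !ffunE => fj.
under eq_bigr => i _ do rewrite ffunE -scalerAr.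
by rewrite -scaler_sumr [X in _ *: X]fj scaler0.
Qed.

(** The pairing is perfect: the [j]-th coordinate on [N], extended to the whole
    space through a projection onto [N], is a linear form, hence the pairing
    with the function of its values on the standard basis; this function is
    dual to the [j]-th basis vector. *)
Lemma pairing_onto N : limg (linfun (pairing N)) = fullv.
Proof.
apply/eqP; rewrite eqEsubv subvf; apply/subvP => y _.
pose e i : {ffun I -> k^o} := [ffun i' => (i == i')%:R].
pose l g := \sum_(j < \dim N) y j * coord (vbasis N) j (projv N g).
have lE g : l g = dot [ffun i => l (e i)] g.
  rewrite /dot; have {1}-> : g = \sum_i g i *: e i.
    apply/ffunP => i; rewrite sum_ffunE (bigD1 i) //= big1 ?addr0 => [|j ji].
      by rewrite !ffunE eqxx [_ *: _]mulr1.
    by rewrite !ffunE (negbTE ji) scaler0.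
  rewrite /l; under [RHS]eq_bigr => i _ do rewrite ffunE mulr_suml.
  rewrite exchange_big /=; apply: eq_bigr => j _.
  rewrite !linear_sum mulr_sumr; apply: eq_bigr => i _.
  by rewrite !linearZ /= mulrCA mulrC.
suff -> : y = linfun (pairing N) [ffun i => l (e i)] by rewrite memv_img ?memvf.
apply/ffunP => j; rewrite lfunE ffunE -lE /l.
have /andP[_ fr] := vbasisP N.
rewrite projv_id ?vbasis_mem ?mem_nth ?size_tuple //.
rewrite (bigD1 j) //= big1 ?addr0 => [|j' jj']; rewrite coord_free //.
  by rewrite eqxx mulr1.
by rewrite eq_sym (negbTE jj') mulr0.
Qed.

Lemma dim_annihilator N : (\dim (annihilator N) + \dim N = #|I|)%N.
Proof.
have := limg_ker_dim (linfun (pairing N)) fullv.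
by rewrite capfv pairing_onto dimv_ffun !dimvf /dim /= card_ord !muln1.
Qed.

End Pairing.

(** * Functions constant on the fibres of a labelling *)

Section FibrewiseConstant.
Variables (k : fieldType) (T Y : finType) (P : {set T}) (q : T -> Y).

(** Only labels taken on [P] index the source, which makes the pullback
    injective. *)
Definition pullback (g : {ffun {y | y \in q @: P} -> k^o}) : {ffun T -> k^o} :=
  [ffun t => if t \in P then oapp g 0 (insub (q t)) else 0].

Fact pullback_is_linear : linear pullback.
Proof.
move=> c x y; apply/ffunP => t; rewrite !ffunE.
case: ifP => tP; last by rewrite scaler0 addr0.
by case: insub => [z|] /=; rewrite ?ffunE ?scaler0 ?addr0.
Qed.

HB.instance Definition _ :=
  GRing.isLinear.Build k {ffun {y | y \in q @: P} -> k^o} {ffun T -> k^o} _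
    pullback pullback_is_linear.

Definition fibrewise_constant : {vspace {ffun T -> k^o}} :=
  limg (linfun pullback).

Lemma fibrewise_constantP (f : {ffun T -> k^o}) :
  reflect ((forall t, t \notin P -> f t = 0) /\
           {in P &, forall s t, q s = q t -> f s = f t})
          (f \in fibrewise_constant).
Proof.
apply: (iffP memv_imgP) => [[g _ ->]|[f0 fq]].
  rewrite lfunE; split=> [t /negbTE tP|s t sP tP eq_q]; first by rewrite ffunE tP.
  by rewrite !ffunE sP tP eq_q.
pose g : {ffun {y | y \in q @: P} -> k^o} := [ffun y =>
  if [pick t in P | q t == val y] is Some t then f t else 0].
exists g; first exact: memvf.
apply/ffunP => t; rewrite lfunE ffunE; case: ifP => [tP|/negbT/f0 //].
rewrite insubT ?imset_f // => qt /=; rewrite ffunE /=.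
case: pickP => [s /andP[sP /eqP eq_q]|/(_ t)]; last by rewrite tP eqxx.
exact: fq.
Qed.

Lemma dim_fibrewise_constant : \dim fibrewise_constant = #|q @: P|.
Proof.
rewrite limg_dim_eq ?dimv_ffun ?card_sig //.
suff /eqP-> : lker (linfun pullback) == 0%VS by rewrite capv0.
apply/lker0P => x y; rewrite !lfunE => /ffunP eq_xy.
apply/ffunP => -[z zP]; case/imsetP: (zP) => t tP zt.
have := eq_xy t; rewrite !ffunE tP -zt.
case: insubP => [u _ zu|/negP//].
by rewrite (_ : u = exist _ z zP) //; apply: val_inj.
Qed.

End FibrewiseConstant.

(** * Components of induced subgraphs *)

Section Layers.
Variables (I T Y : finType) (S : I -> {set T}) (c : I -> T -> Y).

Lemma card_imset_pair :
  #|(fun p : I * T => (p.1, c p.1 p.2)) @: [set p | p.2 \in S p.1]|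
    = (\sum_i #|c i @: S i|)%N.
Proof.
rewrite (_ : _ @: _ = [set z : I * Y | z.2 \in c z.1 @: S z.1]).
  rewrite -sum1_card.
  under [RHS]eq_bigr => i _ do rewrite -sum1_card.
  by rewrite pair_big_dep; apply: eq_bigl => z; rewrite inE.
apply/setP => -[i y]; rewrite inE /=; apply/imsetP/imsetP.
  by case=> -[j t]; rewrite inE /= => tS [-> ->]; exists t.
by case=> t tS ->; exists (i, t); rewrite ?inE.
Qed.

End Layers.

Section Components.
Variable G : graph.
Implicit Types (W : {set G}) (u v w : G) (a : arrow G).

Lemma tail_bar a : tail (bar a) = head a.
Proof. by case: a => e []. Qed.

Lemma head_bar a : head (bar a) = tail a.
Proof. by case: a => e []. Qed.

Lemma barK : involutive (@bar G).
Proof. by case=> e b; rewrite /bar negbK. Qed.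

Lemma adj_in_sym W : symmetric (adj_in W).
Proof.
move=> u w; rewrite /adj_in andbCA; congr [&& _, _ & _].
by apply/existsP/existsP => -[a /andP[? ?]]; exists (bar a);
  rewrite tail_bar head_bar andbC; apply/andP.
Qed.

Lemma sub_adj_in W W' : W \subset W' -> subrel (adj_in W) (adj_in W').
Proof. by move=> /subsetP sW u w /and3P[/sW uW /sW wW ?]; apply/and3P. Qed.

Lemma connect_invariant (T : finType) (Z : Type) (e : rel T) (f : T -> Z) :
  (forall x y, e x y -> f x = f y) -> forall x y, connect e x y -> f x = f y.
Proof.
move=> fe x _ /connectP[p + ->]; elim: p x => //= y p IHp x /andP[/fe-> /IHp].
by [].
Qed.

(** Defined for every vertex, unlike the elements of [components W]: a vertex
    outside [W] is alone in its class ([connected_class_notin]).  For [W] the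
    set of vertices strictly below level [n], the classes of the vertices of
    level at most [n] are thus exactly the vertices of the contracted graph
    [H_n]. *)
Definition connected_class W v : {set G} := [set w | connect (adj_in W) v w].

Lemma mem_connected_class W v : v \in connected_class W v.
Proof. by rewrite inE connect0. Qed.

Lemma connected_class_eq W u w :
  (connected_class W u == connected_class W w) = connect (adj_in W) u w.
Proof.
have csym : connect_sym (adj_in W) by apply/sym_connect_sym/adj_in_sym.
apply/eqP/idP => [/setP/(_ w)|uw]; first by rewrite !inE connect0.
by apply/setP => x; rewrite !inE (same_connect csym uw).
Qed.

Lemma connect_adj_in W u w :
  connect (adj_in W) u w -> u = w \/ u \in W /\ w \in W.
Proof.
have inv : forall x y, adj_in W x y -> (x \in W) = (y \in W).
  by move=> x y /and3P[-> ->].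
move=> uw; have := connect_invariant inv uw; case/connectP: uw => -[|x p] /=.
  by move=> _ ->; left.
by case/andP=> /and3P[-> _ _] _ _ /esym; right.
Qed.

Lemma connected_class_notin W v : v \notin W -> connected_class W v = [set v].
Proof.
move=> vW; apply/setP => w; rewrite !inE.
apply/idP/eqP => [/connect_adj_in[->//|[]]|->]; last exact: connect0.
by rewrite (negbTE vW).
Qed.

Lemma connected_class_sub W v : v \in W -> connected_class W v \subset W.
Proof.
by move=> vW; apply/subsetP => w; rewrite inE => /connect_adj_in[<-|[]].
Qed.

Lemma componentsE W : components W = connected_class W @: W.
Proof.
apply: eq_in_imset => v vW; apply/setP => w; rewrite !inE andb_idl //.
by move=> vw; rewrite (subsetP (connected_class_sub vW)) ?inE.
Qed.

Lemma connected_class_component W v Xi : Xi \in components W ->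
  (v \in Xi) = (connected_class W v == Xi).
Proof.
rewrite componentsE => /imsetP[u _ ->].
by rewrite inE eq_sym connected_class_eq.
Qed.

(** The classes of the vertices of [W'] are the components of [W] and the
    singletons of [W' :\: W]. *)
Lemma card_connected_class_imset W W' : W \subset W' ->
  (#|connected_class W @: W'| + #|W| = #|components W| + #|W'|)%N.
Proof.
move=> sW; have {1}-> : W' = W :|: (W' :\: W).
  by rewrite -{1}(setID W' W) (setIidPr sW).
rewrite imsetU -componentsE.
have -> : connected_class W @: (W' :\: W) = set1 @: (W' :\: W).
  by apply: eq_in_imset => v /setDP[_ vW]; rewrite connected_class_notin.
rewrite cardsU disjoint_setI0 ?cards0 ?subn0.
  rewrite (card_imset _ set1_inj) -(cardsID W W') (setIidPr sW).
  by rewrite [(#|W| + _)%N]addnC addnA.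
rewrite disjoint_subset; apply/subsetP => _ /[!componentsE] /imsetP[u uW ->].
rewrite inE; apply/imsetP => -[v /setDP[_ /negP vW] uv]; apply: vW.
rewrite (subsetP (connected_class_sub uW)) // uv; exact: set11.
Qed.

End Components.

(** * Potentials and their coboundaries *)

Section Residue.
Variables (k : fieldType) (G : graph) (pi : ordered_partition G).
Implicit Types (v : G) (a : arrow G).

Local Notation lev := (level pi).
Local Notation height := 'I_(size pi).+1.
Local Notation class n := (connected_class (below pi n)).

Lemma level_lt v : (lev v < (size pi).+1)%N.
Proof.
rewrite ltnS -has_find; case: pi => s us /= /and3P[/eqP cov _ _].
have : v \in cover [set B in s] by rewrite cov inE.
by case/bigcupP => B; rewrite inE => Bs vB; apply/hasP; exists B.
Qed.

Lemma in_below n v : (v \in below pi n) = (lev v < n)%N.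
Proof. by rewrite inE. Qed.

Lemma below0 : below pi 0 = set0.
Proof. by apply/setP => v; rewrite !inE. Qed.

Lemma below_all : below pi (size pi).+1 = [set: G].
Proof. by apply/setP => v; rewrite !inE level_lt. Qed.

Lemma subset_belowS n : below pi n \subset below pi n.+1.
Proof. by apply/subsetP => v; rewrite !in_below => /ltnW. Qed.

Definition ord_level v : height := inord (lev v).

Lemma val_ord_level v : ord_level v = lev v :> nat.
Proof. by rewrite inordK ?level_lt. Qed.

Definition top_level (e : edge G) : height :=
  inord (maxn (lev (ends e).1) (lev (ends e).2)).

Lemma val_top_level a :
  top_level a.1 = maxn (lev (tail a)) (lev (head a)) :> nat.
Proof.
case: a => e b; rewrite /top_level inordK /tail /head /=.
  by case: b; rewrite 1?maxnC.
by rewrite gtn_max !level_lt.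
Qed.

(** One copy of the subgraph on the levels at most [n], for each [n].  The index
    [n = 0] contributes nothing, levels being positive. *)
Definition layered : {set height * G} :=
  [set p : height * G | p.2 \in below pi p.1.+1].

Definition lower_class (p : height * G) := (p.1, class p.1 p.2).
Definition upper_class (p : height * G) := (p.1, class p.1.+1 p.2).

(** Functions on the disjoint union of the contracted graphs [H_n]: by
    [connected_class_notin], a vertex of level exactly [n] is alone in its
    class, while a component strictly below [n] is a single class. *)
Definition potentials := fibrewise_constant k layered lower_class.

Definition coboundary (F : {ffun height * G -> k^o}) : {ffun edge G -> k^o} :=
  [ffun e => F (top_level e, (ends e).1) - F (top_level e, (ends e).2)].

Fact coboundary_is_linear : linear coboundary.
Proof.
move=> c x y; apply/ffunP => e; rewrite !ffunE scalerBr.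
by rewrite opprD addrACA.
Qed.

HB.instance Definition _ :=
  GRing.isLinear.Build k {ffun height * G -> k^o} {ffun edge G -> k^o} _
    coboundary coboundary_is_linear.

Lemma coboundary0_arrow (F : {ffun height * G -> k^o}) a :
  coboundary F = 0 -> F (top_level a.1, tail a) = F (top_level a.1, head a).
Proof.
move=> /ffunP/(_ a.1); rewrite !ffunE => /eqP; rewrite subr_eq0 => /eqP.
by case: a => e []; rewrite /tail /head.
Qed.

(** An edge of the subgraph on the levels at most [n] either lies strictly below
    [n], and a potential then agrees at its ends, or has top level [n], and the
    vanishing of the coboundary makes the potential agree at its ends. *)
Lemma ker_coboundary :
  (potentials :&: lker (linfun coboundary))%VS
    = fibrewise_constant k layered upper_class.
Proof.
apply/vspaceP => F; rewrite memv_cap memv_ker lfunE /=.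
apply/andP/fibrewise_constantP => [[/fibrewise_constantP[F0 Fq] /eqP dF]|[F0 Fq]].
  split=> // -[n u] [m w]; rewrite !inE /= => uP wP -[<-{m wP} /eqP].
  rewrite connected_class_eq.
  apply: (connect_invariant (f := fun x => F (n, x))) => {u w uP} u w.
  case/and3P=> un wn /existsP[a /andP[/eqP au /eqP aw]].
  have [lown|] := boolP ((u \in below pi n) && (w \in below pi n)).
    apply: Fq; rewrite ?inE // -1?in_below //.
    congr (_, _); apply/eqP; rewrite connected_class_eq connect1 //.
    case/andP: lown => u' w'; apply/and3P; split=> //.
    by apply/existsP; exists a; rewrite au aw !eqxx.
  rewrite !in_below -gtn_max -leqNgt => nle.
  suff -> : n = top_level a.1 by rewrite -{1}au -aw; exact: coboundary0_arrow.
  apply/val_inj/eqP; rewrite /= val_top_level au aw eqn_leq nle geq_max.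
  by move: un wn; rewrite !in_below !ltnS => -> ->.
split.
  apply/fibrewise_constantP; split=> // -[n u] [m w] uP wP [nm].
  rewrite -{m}nm in wP * => /eqP; rewrite connected_class_eq => uw.
  apply: Fq => //; congr (_, _); apply/eqP; rewrite connected_class_eq /=.
  apply: connect_sub uw => x y xy; apply: connect1.
  exact: sub_adj_in (subset_belowS n) _ _ xy.
apply/eqP/ffunP => e; rewrite !ffunE; apply/eqP; rewrite subr_eq0; apply/eqP.
have [u1 u2] : (ends e).1 \in below pi (top_level e).+1
             /\ (ends e).2 \in below pi (top_level e).+1.
  by rewrite !in_below !ltnS (val_top_level (e, false)) leq_maxl leq_maxr.
apply: Fq; rewrite ?inE // -1?in_below //.
congr (_, _); apply/eqP; rewrite connected_class_eq connect1 //=.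
by apply/and3P; split=> //; apply/existsP; exists (e, false); rewrite !eqxx.
Qed.

(** At height [n] the lower classes number [#|pi_n| + c n] and the upper ones
    [c n.+1]; the sum over [n] telescopes, [c 0] being zero. *)
Lemma card_lower_upper_class :
  (#|lower_class @: layered| + #|components [set: G]|
    = #|upper_class @: layered| + #|G|)%N.
Proof.
pose S (n : height) := below pi n.+1.
rewrite (card_imset_pair S (fun n => class n)).
rewrite (card_imset_pair S (fun n => class n.+1)) {}/S.
rewrite -cardsT -below_all.
have cE n : class n @: below pi n = components (below pi n).
  by rewrite componentsE.
elim: (size pi).+1 => [|m IHm].
  by rewrite !big_ord0 below0 componentsE imset0 !cards0.
rewrite !big_ord_recr /= cE.
have := card_connected_class_imset (subset_belowS m).
move: IHm; move: (\sum_(i < m) _)%N (\sum_(i < m) _)%N => s1 s2.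
by move: #|_| #|_| #|_| #|_| #|_|; lia.
Qed.

(** * The residue space as an annihilator *)

(** The flow [phi] runs from [(ends e).1] to [(ends e).2], hence the sign; the
    opposite values on the two arrows of a horizontal edge give (R3). *)
Definition flow_residue (phi : {ffun edge G -> k^o}) : {ffun arrow G -> k^o} :=
  [ffun a => if downward pi a then 0 else (-1) ^+ a.2 * phi a.1].

Fact flow_residue_is_linear : linear flow_residue.
Proof.
move=> c x y; apply/ffunP => a; rewrite !ffunE.
by case: ifP => _; rewrite ?scaler0 ?addr0 // mulrDr -scalerAr.
Qed.

HB.instance Definition _ :=
  GRing.isLinear.Build k {ffun edge G -> k^o} {ffun arrow G -> k^o} _
    flow_residue flow_residue_is_linear.

Lemma downward_bar a : downward pi (bar a) = upward pi a.
Proof. by rewrite /downward tail_bar head_bar. Qed.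

Lemma flow_residue_inj : injective flow_residue.
Proof.
move=> x y /ffunP eq_xy; apply/ffunP => e.
have := eq_xy (e, false); have := eq_xy (e, true); rewrite !ffunE /=.
rewrite -[(e, true)]/(bar (e, false)) downward_bar /upward /downward.
case: ltnP => [lt_l _|_].
  by rewrite ltnNge ltnW //= !expr0 !mul1r.
by rewrite !expr1 !mulN1r => /oppr_inj.
Qed.

(** Summation by parts.  An arrow that is not downward contributes at its tail,
    in the copy indexed by the level of this tail: this is the pairing with the
    sums in (R2).  A downward arrow carries minus the value of its reverse, and
    contributes in the copy above its own tail: this is the pairing with the
    sums in (R4). *)
Lemma dot_coboundary phi F (psi := flow_residue phi) :
  dot phi (coboundary F)
    = \sum_v F (ord_level v, v) * \sum_(a in arrows_from v) psi a
    - \sum_(a | upward pi a) psi a * F (ord_level (tail a), head a).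
Proof.
have -> : dot phi (coboundary F)
    = \sum_(a : arrow G) (-1) ^+ a.2 * phi a.1 * F (top_level a.1, tail a).
  rewrite -(pair_big xpredT xpredT (fun (e : edge G) (b : bool) =>
    (-1) ^+ b * phi e * F (top_level e, tail (e, b)))) /=.
  apply: eq_bigr => e _; rewrite big_bool ffunE /tail /=.
  by rewrite expr1 expr0 mul1r mulN1r mulrBr mulNr addrC.
rewrite (bigID (downward pi)) [LHS]addrC /=; congr (_ + _).
  under [RHS]eq_bigr => v _ do rewrite mulr_sumr.
  rewrite (exchange_big_dep xpredT) //= big_mkcond /=; apply: eq_bigr => a _.
  rewrite (big_pred1 (tail a)) => [|v]; last by rewrite inE eq_sym.
  rewrite ffunE; case: (boolP (downward pi a)) => /= [_|]; first by rewrite mulr0.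
  rewrite /downward -leqNgt => le_ht; rewrite mulrC; congr (F (_, _) * _).
  by apply: val_inj; rewrite /= val_top_level val_ord_level; apply/maxn_idPl.
rewrite (reindex_inj (inv_inj (@barK G))) -sumrN /=.
apply: eq_big => a; rewrite downward_bar // => up_a.
rewrite ffunE ifN ?tail_bar; last by rewrite /downward -leqNgt ltnW.
rewrite -!mulNr; congr (_ * _ * F (_, _)).
  by case: (a.2); rewrite ?expr1 ?expr0 ?opprK.
by apply: val_inj; rewrite /= val_top_level val_ord_level; apply/maxn_idPl/ltnW.
Qed.

(** The indicators of the vertices of [H_n] as potentials: testing a flow against
    them gives (R2) and (R4), one condition for each vertex of [H_n]. *)
Definition class_indicator (z : height * {set G}) : {ffun height * G -> k^o} :=
  [ffun p => ((p \in layered) && (lower_class p == z))%:R].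

Lemma class_indicator_potential z : class_indicator z \in potentials.
Proof.
apply/fibrewise_constantP; split=> [p /negbTE pP|p q pP qP eq_pq].
  by rewrite ffunE pP.
by rewrite !ffunE pP qP eq_pq.
Qed.

Lemma class_indicator_vertex v p :
  class_indicator (ord_level v, [set v]) p = (p == (ord_level v, v))%:R.
Proof.
rewrite ffunE; congr (nat_of_bool _)%:R; case: p => n u.
rewrite !inE !xpair_eqE; have [-> /=|] := eqVneq n; last by rewrite andbF.
have clv : class (ord_level v) v = [set v].
  by rewrite connected_class_notin // in_below val_ord_level ltnn.
apply/andP/eqP => [[_ /eqP clu]|->]; last by rewrite clv eqxx val_ord_level.
by apply/set1P; rewrite -clu mem_connected_class.
Qed.

Lemma class_indicator_component (n : height) Xi p :
  Xi \in components (below pi n) ->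
  class_indicator (n, Xi) p = ((p.1 == n) && (p.2 \in Xi))%:R.
Proof.
move=> XiP; rewrite ffunE; congr (nat_of_bool _)%:R; case: p => m u.
rewrite !inE xpair_eqE /=; have [->|] := eqVneq m; last by rewrite andbF.
rewrite (connected_class_component _ XiP) andb_idl // => /eqP clu.
rewrite -in_below (subsetP (subset_belowS n)) //.
have : u \in Xi by rewrite -clu mem_connected_class.
move: XiP; rewrite componentsE => /imsetP[x xW ->].
exact/subsetP/connected_class_sub.
Qed.

(** The value on an edge is read off an arrow that is not downward. *)
Lemma residue_flow psi : psi \in residue_space pi k ->
  exists phi, psi = flow_residue phi.
Proof.
case/residue_spaceP=> res_d _ res_h _.
exists [ffun e =>
  if downward pi (e, false) then - psi (e, true) else psi (e, false)].
apply/ffunP => a; rewrite !ffunE; case: ifP => [/res_d // |].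
case: a => e [] /=; last by rewrite expr0 mul1r => ->.
rewrite -[(e, true)]/(bar (e, false)) downward_bar /upward /downward.
rewrite expr1 mulN1r.
case: (ltngtP (lev (tail _)) (lev (head _))) => // [_|eq_l] _.
  by rewrite opprK.
by apply/eqP; rewrite -addr_eq0 addrC res_h //; apply/eqP.
Qed.

(** In [dot_coboundary] the first sum vanishes by (R2).  In the second, grouping
    the upward arrows by the level of their tail and the component of their head
    takes the constant values of the potential out, and (R4) kills each group. *)
Lemma residue_annihilator phi : flow_residue phi \in residue_space pi k ->
  phi \in annihilator (linfun coboundary @: potentials)%VS.
Proof.
set psi := flow_residue phi => /residue_spaceP[_ res_v _ res_c].
apply/annihilatorP => _ /memv_imgP[F /fibrewise_constantP[_ Fq] ->].
rewrite lfunE /= dot_coboundary -/psi.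
rewrite big1 ?sub0r => [|v _]; last by rewrite res_v mulr0.
pose p a : height * G := (ord_level (tail a), head a).
have pP a : upward pi a -> p a \in layered.
  by rewrite !inE val_ord_level ltnS; exact: ltnW.
apply/eqP; rewrite oppr_eq0; apply/eqP.
rewrite (partition_big (fun a => lower_class (p a)) xpredT) //=.
rewrite big1 // => -[n Xi] _.
have [a0 /andP[up0 /eqP lab0]|none] :=
    pickP (fun a => upward pi a && (lower_class (p a) == (n, Xi)));
  last by rewrite big_pred0.
have lvl0 : ord_level (tail a0) = n by case: lab0.
rewrite (eq_bigr (fun a => psi a * F (p a0))); last first.
  move=> a /andP[up_a /eqP lab].
  by congr (_ * _); apply: Fq; rewrite ?pP // lab.
rewrite -mulr_suml.
have XiP : Xi \in components (below pi n).
  case: lab0 => _ <-; rewrite componentsE lvl0 imset_f //.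
  by rewrite in_below -lvl0 val_ord_level.
have n_bounds : (1 <= n <= size pi)%N.
  by apply/andP; split; [rewrite -lvl0 val_ord_level | rewrite -ltnS].
suff -> : \sum_(a | upward pi a && (lower_class (p a) == (n, Xi))) psi a = 0.
  by rewrite mul0r.
rewrite -[RHS](res_c n n_bounds Xi XiP); apply: eq_bigl => a; congr (_ && _).
rewrite (connected_class_component _ XiP) /lower_class /p /= xpair_eqE.
by rewrite -val_eqE /= val_ord_level; case: eqP => // ->.
Qed.

(** Each indicator makes one of the two sums of [dot_coboundary] vanish, and
    turns the other into the sum of the wanted condition.  For the class of a
    vertex [v], the second sum vanishes: the head of an upward arrow lies
    strictly below its tail, so it is not [v] when the tail has the level of
    [v].  For a component strictly below level [n], the first sum vanishes: none
    of its vertices has level [n]. *)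
Lemma annihilator_residue phi :
  phi \in annihilator (linfun coboundary @: potentials)%VS ->
  flow_residue phi \in residue_space pi k.
Proof.
move=> /annihilatorP phiN; set psi := flow_residue phi.
have test z :
    \sum_v class_indicator z (ord_level v, v) * \sum_(a in arrows_from v) psi a
    = \sum_(a | upward pi a) psi a * class_indicator z (ord_level (tail a), head a).
  apply/eqP; rewrite -subr_eq0 -dot_coboundary; apply/eqP.
  rewrite -[coboundary _](lfunE coboundary) phiN // memv_img //.
  exact: class_indicator_potential.
apply/residue_spaceP; split.
- by move=> a da; rewrite ffunE da.
- move=> v; pose z := (ord_level v, [set v]).
  transitivity (\sum_u class_indicator z (ord_level u, u)
                * \sum_(a in arrows_from u) psi a).
    rewrite [RHS](bigD1 v) //= [X in _ = _ + X]big1 ?addr0 => [|u uv].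
      by rewrite class_indicator_vertex eqxx mul1r.
    by rewrite class_indicator_vertex xpair_eqE (negbTE uv) andbF mul0r.
  rewrite test big1 // => a up_a.
  rewrite class_indicator_vertex xpair_eqE -val_eqE /= !val_ord_level.
  have [eq_l /=|] := eqP; last by rewrite mulr0.
  case: eqP => [hv|]; last by rewrite mulr0.
  by move: up_a; rewrite /upward hv eq_l ltnn.
- move=> a /eqP eq_l; rewrite !ffunE /downward tail_bar head_bar eq_l ltnn.
  by case: a {eq_l} => e [] /=; rewrite expr0 expr1 mul1r mulN1r ?addNr ?addrN.
move=> m /andP[_ m_le] Xi; pose n : height := Ordinal (m_le : (m < (size pi).+1)%N).
rewrite -[m]/(n : nat) => XiP.
transitivity (\sum_(a | upward pi a)
    psi a * class_indicator (n, Xi) (ord_level (tail a), head a)).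
  rewrite big_mkcondr; apply: eq_bigr => a _.
  rewrite class_indicator_component //= -val_eqE /= val_ord_level.
  by case: ifP; rewrite ?mulr1 ?mulr0.
rewrite -(test (n, Xi)) big1 // => v _; rewrite class_indicator_component //=.
have [lv /=|] := eqP; last by rewrite mul0r.
have [vXi|_] := boolP (v \in Xi); last by rewrite mul0r.
move: XiP; rewrite componentsE => /imsetP[x xW XiE].
have := subsetP (connected_class_sub xW) v; rewrite -XiE => /(_ vXi).
by rewrite in_below -lv val_ord_level ltnn.
Qed.

Lemma dim_residue_space :
  \dim (residue_space pi k)
    = \dim (annihilator (linfun coboundary @: potentials)%VS).
Proof.
have -> : residue_space pi k
    = (linfun flow_residue @: annihilator (linfun coboundary @: potentials))%VS.
  apply/vspaceP => psi; apply/idP/memv_imgP => [psiR|[phi phiN ->]].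
    have [phi psiE] := residue_flow psiR.
    by exists phi; rewrite ?lfunE //; apply: residue_annihilator; rewrite -psiE.
  by rewrite lfunE; exact: annihilator_residue.
rewrite limg_dim_eq //; suff /eqP-> : lker (linfun flow_residue) == 0%VS.
  by rewrite capv0.
by apply/lker0P => x y; rewrite !lfunE; exact: flow_residue_inj.
Qed.

End Residue.

Theorem theorem1p1 (k : fieldType) (G : graph) (pi : ordered_partition G) :
  (\dim (residue_space pi k))%:Z
    = #|edge G|%:Z - #|vertex G|%:Z + #|components [set: G]|%:Z.
Proof.
have := dim_annihilator (linfun (@coboundary k G pi) @: potentials k pi)%VS.
have := limg_ker_dim (linfun (@coboundary k G pi)) (potentials k pi).
rewrite ker_coboundary /potentials !dim_fibrewise_constant dim_residue_space.
have := card_lower_upper_class pi.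
move: #|_| #|_| #|_| #|_| #|_| (\dim _) (\dim _). lia.
Qed.
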